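(* In the setting of the context, let $\widehat\zeta\in\mathbb{R}$ be an approximation to $\zeta$, let $\widehat\varphi=f(\widehat\zeta)$ and let $\widehat b_n$ be computed from $\widehat\varphi$ with $\widehat b_0=b_0=a$. Assume relative errors are well defined, i.e. $\zeta$, $\varphi_n$, $b_n$ are nonzero wherever they appear as denominators. Then: (a) $E_{\mathrm{abs}}(\widehat\varphi_n)=T_n^+\,E_{\mathrm{abs}}(\widehat\zeta)$ for $n\ge 0$; (b) $E_{\mathrm{rel}}(\widehat\varphi_n)=\zeta\frac{T_n^+}{\varphi_n}E_{\mathrm{rel}}(\widehat\zeta)=\frac{\zeta}{\zeta-Z_n}E_{\mathrm{rel}}(\widehat\zeta)$ for $n\ge 0$; (c) $E_{\mathrm{abs}}(\widehat b_n)=T_{0n}\,E_{\mathrm{abs}}(\widehat\zeta)$ for $n\ge 1$; (d) $E_{\mathrm{rel}}(\widehat b_n)=\zeta\frac{T_{0n}}{b_n}E_{\mathrm{rel}}(\widehat\zeta)=\frac{\zeta}{a/T_{0n}+\zeta-Z_{0n}}E_{\mathrm{rel}}(\widehat\zeta)$ for $n\ge 1$.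
   Context: Let $\{X(t)\}_{t\ge 0}$ be a continuous-time birth--death Markov chain on $\mathbb{N}_0=\{0,1,2,\dots\}$ with birth rates $\lambda_n>0$ ($n\ge 0$), death rates $\mu_n>0$ ($n\ge 1$) and $\mu_0=0$. Set $\pi_0=1$, $\pi_n=\frac{\lambda_0\cdots\lambda_{n-1}}{\mu_1\cdots\mu_n}$ for $n\ge1$. Standing assumption: $\sum_{n\ge 0} 1/(\lambda_n\pi_n)=\infty$ and $\sum_{n\ge 0}\pi_n<\infty$ (the process is uniquely determined by its rates and ergodic). The steady-state probabilities are $p_n=\pi_n/\sum_{j\ge 0}\pi_j$. Cost rates $c_n\in\mathbb{R}$ satisfy $\sum_n |c_n|p_n<\infty$, and $\zeta:=\sum_n c_np_n$. $P_n:=\sum_{j=0}^n p_j$, $C_n:=\sum_{j=0}^n c_jp_j$, $Z_n:=C_n/P_n$. With $\tau_n:=\min\{t\ge 0: X(t)=n\}$ and $\mathbb{E}_n$ the expectation given $X(0)=n$: $T_n^+:=\mathbb{E}_n[\tau_{n+1}]$, $T_{0n}:=\mathbb{E}_0[\tau_n]$, $H_{0n}:=\mathbb{E}_0[\int_0^{\tau_n}c_{X(s)}\,ds]$, $Z_{0n}:=H_{0n}/T_{0n}$ ($n\ge 1$). For $z\in\mathbb{R}$, $f(z)$ is given by the forward recurrence $f_0(z)=\frac{z-c_0}{\lambda_0}$, $f_n(z)=\frac{z-c_n}{\lambda_n}+\frac{\mu_n}{\lambda_n}f_{n-1}(z)$, $n\ge 1$. Put $\varphi_n:=f_n(\zeta)$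 and, for given $a\in\mathbb{R}$, $b_0=a$, $b_n=a+\sum_{j=0}^{n-1}\varphi_j$ (the solution of Poisson's equation with $b_0=a$). Likewise $\widehat\varphi_n:=f_n(\widehat\zeta)$, $\widehat b_0=a$, $\widehat b_n=a+\sum_{j=0}^{n-1}\widehat\varphi_j$. For an approximation $\widehat x$ to $x$: $E_{\mathrm{abs}}(\widehat x):=\widehat x-x$ and $E_{\mathrm{rel}}(\widehat x):=E_{\mathrm{abs}}(\widehat x)/x$ (if $x\ne 0$). *)

(* Defs.v *)
From HB Require Import structures.
From mathcomp Require Import all_boot all_order all_algebra.
From mathcomp Require Import all_classical all_reals all_analysis.

Set Implicit Arguments.
Unset Strict Implicit.
Unset Printing Implicit Defensive.
Import Order.TTheory GRing.Theory Num.Theory.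
Import numFieldTopology.Exports numFieldNormedType.Exports.
Local Open Scope classical_set_scope.
Local Open Scope ring_scope.

Definition generator (R : realType) (lam mu : nat -> R) (i j : nat) : R :=
  if j == i.+1 then lam i
  else if i == j.+1 then mu i
  else if i == j then - (lam i + mu i)
  else 0.

(* [X] is indexed by all of [R], but only its values at times [t >= 0] are
   constrained or used; [P i] is the law of the process started at [X 0 = i]. *)
Record birth_death_chain (R : realType) (d : measure_display)
    (Omega : measurableType d) (lam mu : nat -> R)
    (P : nat -> probability Omega R) (X : R -> Omega -> nat) : Prop := {
  bdc_measurable : forall (t : R) (j : nat), 0 <= t ->
    measurable [set w | X t w = j];
  bdc_init : forall i : nat, P i [set w | X 0 w = i] = 1%E;
  (* right-continuity of the paths, for the discrete topology on the states *)
  bdc_right_continuous : forall (w : Omega) (t : R), 0 <= t ->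
    \forall s \near t^'+, X s w = X t w;
  (* time-homogeneous Markov property: conditionally on [X s = j] and on any
     event prescribing finitely many values of [X] up to time [s], the state
     at time [s + h] is distributed as the state at time [h] under [P j];
     multiplied out, so that conditioning on a null event is harmless *)
  bdc_markov : forall (i j k : nat) (s h : R) (past : seq (R * nat)),
    0 <= s -> 0 <= h ->
    (forall q, q \in past -> 0 <= q.1 <= s) ->
    let A := [set w | forall q, q \in past -> X q.1 w = q.2] in
    P i (A `&` [set w | X s w = j] `&` [set w | X (s + h) w = k]) =
    (P i (A `&` [set w | X s w = j]) * P j [set w | X h w = k])%E;
  (* [P_i(X(h) = j) = (i == j) + generator i j * h + o(h)] as [h -> 0+] *)
  bdc_rates : forall i j : nat,
    (fine (P i [set w | X h w = j]) - (i == j)%:R) / h @[h --> 0^'+]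
      --> generator lam mu i j
}.

Section stationary.
Variables (R : realType) (lam mu c : nat -> R).

Definition bd_pi (n : nat) : R :=
  (\prod_(0 <= i < n) lam i) / (\prod_(1 <= i < n.+1) mu i).

Definition bd_p (n : nat) : R := bd_pi n / limn (series bd_pi).

Definition zeta : R := limn (series (fun n => c n * bd_p n)).

Definition Pcum (n : nat) : R := \sum_(0 <= j < n.+1) bd_p j.

Definition Ccum (n : nat) : R := \sum_(0 <= j < n.+1) c j * bd_p j.

Definition Zcum (n : nat) : R := Ccum n / Pcum n.

Fixpoint frec (z : R) (n : nat) : R :=
  match n with
  | 0 => (z - c 0%N) / lam 0%N
  | m.+1 => (z - c m.+1) / lam m.+1 + mu m.+1 / lam m.+1 * frec z m
  end.

(* [bias a z] is the sequence b of partial sums when z = zeta, and its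
   perturbed version when z is an approximation of zeta. *)
Definition bias (a z : R) (n : nat) : R := a + \sum_(0 <= j < n) frec z j.

End stationary.

Section passage.
Variables (R : realType) (d : measure_display) (Omega : measurableType d).
Variables (P : nat -> probability Omega R) (X : R -> Omega -> nat).

(* The infimum is a minimum when the set is nonempty, the paths being
   right-continuous; it is [+oo] when the state is never visited. *)
Definition tau (n : nat) (w : Omega) : \bar R :=
  ereal_inf [set t%:E | t in [set t : R | 0 <= t /\ X t w = n]].

Definition Tplus (n : nat) : R := fine (\int[P n]_w tau n.+1 w)%E.

Definition T0 (n : nat) : R := fine (\int[P 0%N]_w tau n w)%E.

Definition H0 (c : nat -> R) (n : nat) : R :=
  fine (\int[P 0%N]_w
    \int[lebesgue_measure]_(s in [set s : R | (0 <= s)%R /\ s%:E < tau n w])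
      (c (X s w))%:E)%E.

Definition Z0 (c : nat -> R) (n : nat) : R := H0 c n / T0 n.

End passage.

Definition Eabs (R : realType) (xhat x : R) : R := xhat - x.

Definition Erel (R : realType) (xhat x : R) : R := Eabs xhat x / x.

(* Main.v *)
Require Import Defs.
From HB Require Import structures.
From mathcomp Require Import all_boot all_order all_algebra.
From mathcomp Require Import all_classical all_reals all_analysis.
From mathcomp Require Import measurable_realfun.
From mathcomp Require Import ring lra.

Set Implicit Arguments.
Unset Strict Implicit.
Unset Printing Implicit Defensive.
Import Order.TTheory GRing.Theory Num.Theory.
Import numFieldTopology.Exports numFieldNormedType.Exports.
Local Open Scope classical_set_scope.
Local Open Scope ring_scope.

(* [frec z n] is affine in [z]: its slope and its constant term are the expected
   time and minus the expected cost incurred between the first visits to [n] and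
   to [n.+1], so everything reduces to computing such expectations.

   For that, the chain is watched on the dyadic grids of mesh [2^-m] and killed
   when it is seen outside [{n | n < N}].  By the Markov property the killed
   skeleton has a substochastic transition matrix, which by the rates is [1]
   plus the mesh times the restricted generator, up to [o(2^-m)].  Since
   [path_cost g] solves Poisson's equation for the generator, telescoping shows
   that the total skeleton cost converges to it.  By right-continuity the
   skeleton cost also converges pathwise to the cost up to the exit from
   [{n | n < N}], with a domination because killing on a coarse grid is later
   than on a fine one.  Finally the exit is almost surely at [N]: a jump over [N]
   would be seen on all fine grids, which has probability [o(1)]. *)

(** * Dyadic grids of mesh [2^-m] *)

Definition grid (R : realType) (m l : nat) : R := l%:R / 2 ^+ m.

Definition grid_index (R : realType) (m : nat) (s : R) : nat :=
  Num.truncn (s * 2 ^+ m).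

Section grid.
Variable R : realType.
Implicit Types (s t e : R) (m l : nat).

Lemma expr2n_gt0 m : 0 < 2 ^+ m :> R.
Proof. exact: exprn_gt0. Qed.

Lemma grid_ge0 m l : 0 <= grid R m l.
Proof. by rewrite divr_ge0 // ltW // expr2n_gt0. Qed.

Lemma ler_grid m l l' : (l <= l')%N -> grid R m l <= grid R m l'.
Proof. by move=> ll'; rewrite ler_pM2r ?invr_gt0 ?expr2n_gt0 // ler_nat. Qed.

Lemma grid_double m k l : grid R m l = grid R (k + m) (l * 2 ^ k).
Proof.
rewrite /grid natrM natrX exprD; field.
by rewrite !expf_neq0.
Qed.

Lemma grid_le m l s : 0 <= s -> (grid R m l <= s) = (l <= grid_index m s)%N.
Proof.
move=> s0; rewrite /grid ler_pdivrMr ?expr2n_gt0 //.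
by rewrite truncn_ge_nat // mulr_ge0 // ltW // expr2n_gt0.
Qed.

Lemma grid_index_le m s : 0 <= s -> grid R m (grid_index m s) <= s.
Proof. by move=> s0; rewrite grid_le. Qed.

Lemma lt_next_grid m s : s < grid R m (grid_index m s).+1.
Proof. by rewrite /grid ltr_pdivlMr ?expr2n_gt0 // truncnS_gt. Qed.

Lemma next_grid_le m s : 0 <= s ->
  grid R m (grid_index m s).+1 <= s + (2 ^+ m)^-1.
Proof.
move=> s0; rewrite /grid -natr1 mulrDl mul1r lerD2r.
exact: grid_index_le.
Qed.

Lemma grid_index_eq m l s : 0 <= s ->
  (grid_index m s == l) = (grid R m l <= s < grid R m l.+1).
Proof.
move=> s0; rewrite truncn_eq; last by rewrite mulr_ge0 // ltW // expr2n_gt0.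
by rewrite /grid ler_pdivrMr ?expr2n_gt0 // ltr_pdivlMr ?expr2n_gt0.
Qed.

Lemma le_grid_index m s t : s <= t -> (grid_index m s <= grid_index m t)%N.
Proof.
by move=> st; apply: le_truncn; rewrite ler_wpM2r // ltW // expr2n_gt0.
Qed.

Lemma near_mesh_lt e : 0 < e -> \forall m \near \oo, (2 ^+ m)^-1 < e.
Proof.
move=> e0; have := near_infty_natSinv_expn_lt (PosNum e0).
by apply: filterS => m; rewrite div1r.
Qed.

Lemma mesh_cvg0r : (2 ^+ m)^-1 @[m --> \oo] --> (0 : R)^'+.
Proof.
move=> A [e /= e0 Ae].
suff : \forall m \near \oo, A (2 ^+ m)^-1 by [].
near=> m; apply: Ae => /=.
  rewrite sub0r normrN gtr0_norm ?invr_gt0 ?expr2n_gt0 //.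
  by near: m; exact: near_mesh_lt.
by rewrite invr_gt0 expr2n_gt0.
Unshelve. all: by end_near. Qed.

End grid.

(** * Right-continuous paths observed on dyadic grids *)

Section path.
Variables (R : realType) (x : R -> nat).
Hypothesis x_rc : forall t, 0 <= t -> \forall s \near t^'+, x s = x t.
Implicit Types (K : pred nat) (s t : R).

Definition alive K (m n : nat) : bool :=
  all (fun l => K (x (grid R m l))) (iota 0 n).

Definition survives K s : Prop := forall t, 0 <= t <= s -> K (x t).

Lemma aliveP K m n :
  reflect (forall l, (l < n)%N -> K (x (grid R m l))) (alive K m n).
Proof.
apply: (iffP allP) => [H l ln|H l]; first by apply: H; rewrite mem_iota.
by rewrite mem_iota => /andP[_]; exact: H.
Qed.

Lemma aliveS K m n : alive K m n.+1 = alive K m n && K (x (grid R m n)).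
Proof. by rewrite /alive -addn1 iotaD all_cat /= andbT. Qed.

Lemma right_locally_constant t : 0 <= t ->
  exists2 e, 0 < e & forall s, t <= s < t + e -> x s = x t.
Proof.
move=> /x_rc[e /= e0 H]; exists e => // s /andP[].
rewrite le_eqVlt => /predU1P[<- //|ts] se; apply: H => //=.
by rewrite ltr_distlC; lra.
Qed.

Lemma survives_right K s : 0 <= s -> survives K s ->
  exists2 e, 0 < e & forall t, 0 <= t < s + e -> K (x t).
Proof.
move=> s0 Ks; have [e e0 xe] := right_locally_constant s0.
exists e => // t /andP[t0 te]; have [ts|st] := lerP t s.
  by apply: Ks; rewrite t0 ts.
by rewrite xe; [apply: Ks; rewrite s0 lexx | rewrite (ltW st) te].
Qed.

(** The sampling point is the first one strictly after [s]: it approaches [s] from the right, the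
    only side on which the path is controlled. *)
Lemma next_grid_cvg s : 0 <= s ->
  \forall m \near \oo, x (grid R m (grid_index m s).+1) = x s.
Proof.
move=> s0; have [e e0 xe] := right_locally_constant s0.
near=> m; apply: xe; rewrite (ltW (lt_next_grid m s)) /=.
apply: le_lt_trans (next_grid_le m s0) _; rewrite ltrD2l.
by near: m; exact: near_mesh_lt.
Unshelve. all: by end_near. Qed.

(** The count [.+2] includes the first grid point after [s]. If the path survives up to [s],
    right-continuity carries survival slightly past [s], hence to that point. If it fails at some
    [t <= s], the first grid point after [t] eventually sees the failure, and it is among those
    tested. *)
Lemma alive_cvg K s : 0 <= s ->
  \forall m \near \oo, alive K m (grid_index m s).+2 = `[< survives K s >].
Proof.
move=> s0; case: asboolP => [Ks|].
  have [e e0 Ke] := survives_right s0 Ks.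
  near=> m; apply/aliveP => l lm; apply: Ke; rewrite grid_ge0 /=.
  apply: le_lt_trans (ler_grid R m (l' := (grid_index m s).+1) _) _ => //.
  apply: le_lt_trans (next_grid_le m s0) _; rewrite ltrD2l.
  by near: m; exact: near_mesh_lt.
move=> /existsNP[t /not_implyP[/andP[t0 ts] /negP Kt]].
near=> m; apply/negbTE/aliveP => /(_ (grid_index m t).+1).
rewrite !ltnS le_grid_index // => /(_ isT).
suff -> : x (grid R m (grid_index m t).+1) = x t by apply/negP.
by near: m; exact: next_grid_cvg.
Unshelve. all: by end_near. Qed.

(* A path that crosses level [N] without ever taking the value [N] jumps over
   it at its first entrance time into [{n | N <= n}], and that jump is seen on
   every sufficiently fine grid. *)
Lemma crossing_jump (N : nat) s : 0 <= s -> (x 0 < N)%N ->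
  survives (fun n => n != N) s -> ~ survives (fun n => (n < N)%N) s ->
  \forall m \near \oo, exists k,
    alive (fun n => (n < N)%N) m k.+1 /\ (N < x (grid R m k.+1))%N.
Proof.
move=> s0 x0 sN /existsNP[r /not_implyP[/andP[r0 rs] /negP]].
rewrite -leqNgt => xr.
pose E := [set t : R | 0 <= t /\ (N <= x t)%N].
have lbE : lbound E 0 by move=> t [].
have infE : has_inf E by split; [exists r | exists 0].
set sg := inf E.
have sg0 : 0 <= sg by apply: lb_le_inf => //; exists r.
have sgr : sg <= r by apply: ge_inf; [exists 0 | split].
have before t : 0 <= t < sg -> (x t < N)%N.
  move=> /andP[t0 tsg]; rewrite ltnNge; apply/negP => xt.
  by move: tsg; rewrite ltNge ge_inf //; exists 0.
have [e e0 xe] := right_locally_constant sg0.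
(* The infimum is attained: otherwise right-continuity would keep the path below [N] up to
   [sg + e]. *)
have xsg : (N <= x sg)%N.
  rewrite leqNgt; apply/negP => xsg.
  have : sg + e <= sg.
    apply: lb_le_inf; first by exists r.
    move=> t [t0 xt]; rewrite leNgt; apply/negP => te.
    move: xt; rewrite leqNgt => /negP; apply.
    have [tsg|sgt] := ltP t sg; first by apply: before; rewrite t0.
    by rewrite xe // sgt.
  by rewrite gerDl leNgt e0.
have {}xsg : (N < x sg)%N.
  rewrite ltn_neqAle xsg andbT eq_sym; apply: sN.
  by rewrite sg0 (le_trans sgr).
near=> m.
have ex : exists l, (N <= x (grid R m l))%N.
  exists (grid_index m sg).+1; rewrite xe ?(ltnW xsg) //.
  rewrite (ltW (lt_next_grid m sg)) /=.
  apply: le_lt_trans (next_grid_le m sg0) _; rewrite ltrD2l.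
  by near: m; exact: near_mesh_lt.
(* The first grid point seen at or above [N] is not before [sg], and not after the first grid point
   following [sg]. It therefore lies where the path is still equal to [x sg], which exceeds [N]. *)
case: (ex_minnP ex) => l xl lmin.
have lle : (l <= (grid_index m sg).+1)%N.
  apply: lmin; rewrite xe ?(ltnW xsg) //.
  rewrite (ltW (lt_next_grid m sg)) /=.
  apply: le_lt_trans (next_grid_le m sg0) _; rewrite ltrD2l.
  by near: m; exact: near_mesh_lt.
case: l xl lmin lle => [|k] xl lmin lle.
  by move: xl; rewrite /grid mul0r leqNgt x0.
exists k; split.
  apply/aliveP => l lk; rewrite ltnNge; apply/negP => /lmin.
  by rewrite leqNgt lk.
rewrite xe //; apply/andP; split.
  rewrite leNgt; apply/negP => lsg.
  by have := before (grid R m k.+1); rewrite grid_ge0 lsg ltnNge xl => /(_ isT).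
apply: le_lt_trans (ler_grid R m lle) _.
apply: le_lt_trans (next_grid_le m sg0) _; rewrite ltrD2l.
by near: m; exact: near_mesh_lt.
Unshelve. all: by end_near. Qed.

(** Every coarse grid point up to [s] is also a fine one. The coarse count is only [.+1] because the
    coarse point following [s] may lie beyond all the fine points tested. *)
Lemma alive_domination K m k s : 0 <= s ->
  alive K (k + m) (grid_index (k + m) s).+2 -> alive K m (grid_index m s).+1.
Proof.
move=> s0 /aliveP A; apply/aliveP => l; rewrite ltnS -grid_le // => ls.
rewrite (grid_double _ _ k); apply: A; rewrite ltnS ltnW // ltnS.
by rewrite -grid_le // -grid_double.
Qed.

End path.

(** * Poisson's equation for the birth-death generator *)

Section passage_cost.
Variables (R : realType) (lam mu : nat -> R).
Hypothesis lam_gt0 : forall n, 0 < lam n.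
Hypothesis mu_gt0 : forall n, (1 <= n)%N -> 0 < mu n.
Hypothesis mu0 : mu 0%N = 0.
Implicit Types (g c : nat -> R) (n N : nat).

(* Expected cost incurred, at rates [g], between the first visits to [n] and
   to [n.+1]; it is [Tplus n] for [g = 1]. *)
Fixpoint step_cost g n : R :=
  match n with
  | 0 => g 0%N / lam 0%N
  | m.+1 => g m.+1 / lam m.+1 + mu m.+1 / lam m.+1 * step_cost g m
  end.

(** Upward moves have size one, so a passage from [i] to [N] decomposes into the passages from each
    [l] to [l.+1]. *)
Definition path_cost g i N : R := \sum_(i <= l < N) step_cost g l.

Lemma frecE c z n :
  frec lam mu c z n = z * step_cost (fun=> 1) n - step_cost c n.
Proof. by elim: n => [|n IH] /=; rewrite ?IH; ring. Qed.

Lemma biasE c a z n : bias lam mu c a z n =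
  a + (z * path_cost (fun=> 1) 0 n - path_cost c 0 n).
Proof.
rewrite /bias /path_cost mulr_sumr -sumrB; congr (_ + _).
by apply: eq_bigr => j _; rewrite frecE.
Qed.

Lemma bd_pi_gt0 n : 0 < bd_pi lam mu n.
Proof.
apply: divr_gt0; first exact: prodr_gt0.
rewrite big_nat; apply: prodr_gt0 => i /andP[i1 _]; exact: mu_gt0.
Qed.

Lemma bd_piS n : bd_pi lam mu n.+1 = bd_pi lam mu n * lam n / mu n.+1.
Proof.
rewrite /bd_pi big_nat_recr //= (@big_nat_recr _ _ _ n.+1 1) //= invfM.
by ring.
Qed.

(** Solves the recursion by detailed balance, [mu n.+1 * pi n.+1 = lam n * pi n]. It yields the
    positivity of passage times and links step costs to [Zcum]. *)
Lemma step_costE g n : step_cost g n =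
  (\sum_(0 <= j < n.+1) g j * bd_pi lam mu j) / (lam n * bd_pi lam mu n).
Proof.
have l0 k : lam k != 0 by rewrite gt_eqF.
elim: n => [|n IH]; rewrite big_nat_recr //=.
  by rewrite big_geq // add0r /bd_pi big_geq // big_geq // divr1 !mulr1.
have m0 : mu n.+1 != 0 by rewrite gt_eqF // mu_gt0.
have p0 : bd_pi lam mu n != 0 by rewrite gt_eqF // bd_pi_gt0.
rewrite IH bd_piS; field.
by rewrite !l0 m0 p0.
Qed.

Lemma step_cost_ge0 g n : (forall j, 0 <= g j) -> 0 <= step_cost g n.
Proof.
move=> g0; rewrite step_costE divr_ge0 //; last first.
  by rewrite ltW // mulr_gt0 ?bd_pi_gt0.
by apply: sumr_ge0 => j _; rewrite mulr_ge0 // ltW // bd_pi_gt0.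
Qed.

Lemma path_cost_ge0 g i N : (forall j, 0 <= g j) -> 0 <= path_cost g i N.
Proof. by move=> g0; apply: sumr_ge0 => l _; exact: step_cost_ge0. Qed.

Lemma step_cost1_gt0 n : 0 < step_cost (fun=> 1) n.
Proof.
rewrite step_costE; apply: divr_gt0; last by rewrite mulr_gt0 ?bd_pi_gt0.
rewrite big_nat_recr //= mul1r; apply: ltr_wpDl; last exact: bd_pi_gt0.
by apply: sumr_ge0 => j _; rewrite mul1r ltW // bd_pi_gt0.
Qed.

Lemma path_cost1_gt0 n : (0 < n)%N -> 0 < path_cost (fun=> 1) 0 n.
Proof.
case: n => // n _; rewrite /path_cost big_nat_recr //=.
by apply: ltr_wpDl; [exact: path_cost_ge0 | exact: step_cost1_gt0].
Qed.

Lemma step_costB g h n :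
  step_cost (fun k => g k - h k) n = step_cost g n - step_cost h n.
Proof. by elim: n => [|n IH] /=; rewrite ?IH; ring. Qed.

Lemma path_costB g h i N :
  path_cost (fun k => g k - h k) i N = path_cost g i N - path_cost h i N.
Proof. by rewrite -sumrB; apply: eq_bigr => l _; exact: step_costB. Qed.

Lemma sum_delta N a (v : nat -> R) : (a < N)%N ->
  \sum_(k < N) (k == a :> nat)%:R * v k = v a.
Proof.
move=> aN; rewrite (bigD1 (Ordinal aN)) //= eqxx mul1r big1 ?addr0 // => k.
by rewrite -val_eqE /= => /negbTE ->; rewrite mul0r.
Qed.

(** The [N.+1] states keep [j.+1] in range. At [j = 0] the truncated predecessor is [0] itself, so
    the death term vanishes; this agrees with the diagonal entry because [mu 0 = 0]. *)
Lemma generator_action N j (v : nat -> R) : (j < N)%N ->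
  \sum_(k < N.+1) generator lam mu j k * v k =
  lam j * (v j.+1 - v j) + mu j * (v j.-1 - v j).
Proof.
move=> jN; pose d a := fun k : nat => (k == a)%:R : R.
have -> : \sum_(k < N.+1) generator lam mu j k * v k =
    \sum_(k < N.+1) (d j.+1 k * (lam j * v k) + d j.-1 k * (mu j * v k)
                     - d j k * ((lam j + mu j) * v k)).
  apply: eq_bigr => k _; rewrite /generator /d.
  have [->|kj] := eqVneq (k : nat) j.+1.
    by rewrite !gtn_eqF // ?ltnS ?leq_pred //= ?mulr0n ?mulr1n; ring.
  case: j {jN d} kj => [|j] kj /=.
    by rewrite mu0 eq_sym; case: eqP => _; rewrite ?mulr0n ?mulr1n; ring.
  rewrite eqSS (eq_sym j); have [->|kj'] := eqVneq (k : nat) j.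
    by rewrite ltn_eqF // ?mulr0n ?mulr1n; ring.
  by rewrite (eq_sym j.+1); case: eqP => _; rewrite ?mulr0n ?mulr1n; ring.
rewrite sumrB big_split /=.
rewrite (@sum_delta _ _ (fun k => lam j * v k)) //.
rewrite (@sum_delta _ _ (fun k => mu j * v k)); last first.
  by rewrite (leq_ltn_trans (leq_pred j)) // ltnW.
rewrite (@sum_delta _ _ (fun k => (lam j + mu j) * v k)) 1?ltnW //.
by ring.
Qed.

(** Consecutive values of [path_cost g] differ by a step cost, so the equation reduces to [lam j *
    step_cost g j - mu j * step_cost g j.-1 = g j], the recursion defining [step_cost]. *)
Lemma generator_path_cost N g j : (j < N)%N ->
  \sum_(k < N.+1) generator lam mu j k * path_cost g k N = - g j.
Proof.
move=> jN; have l0 k : lam k != 0 by rewrite gt_eqF.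
have pc a : (a < N)%N ->
    path_cost g a N = step_cost g a + path_cost g a.+1 N by exact: big_ltn.
rewrite (@generator_action _ _ (fun k => path_cost g k N)) //.
case: j jN => [|j] jN; first by rewrite mu0 (pc 0%N) //=; field.
by rewrite [j.+1.-1]/= (pc j (ltnW jN)) (pc j.+1 jN) /=; field.
Qed.

Lemma generator_sum0 N j : (j < N)%N ->
  \sum_(k < N.+1) generator lam mu j k = 0.
Proof.
move=> jN; have := @generator_action _ _ (fun=> 1) jN.
rewrite subrr !mulr0 addr0 => h; rewrite -[RHS]h.
by apply: eq_bigr => k _; rewrite mulr1.
Qed.

Lemma path_cost_id g N : path_cost g N N = 0.
Proof. by rewrite /path_cost big_geq. Qed.

End passage_cost.

(** * Total cost of a killed discrete-time chain *)

(* [w k] is the law at step [k] of a chain killed outside [{j | j < N}]; if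
   [u] and [t] nearly solve Poisson's equation for the costs [g] and [1] on
   the scale [dl], then the total cost is close to [u i]. *)
Section killed_chain.
Variables (R : realType) (N i : nat) (Q w : nat -> nat -> R).
Hypothesis iN : (i < N)%N.
Hypothesis w_ge0 : forall k j, 0 <= w k j.
Hypothesis w0 : forall j, w 0 j = (i == j)%:R.
Hypothesis wS : forall k j, w k.+1 j = \sum_(l < N) w k l * Q l j.

Let pairing k (v : nat -> R) := \sum_(j < N) w k j * v j.

Lemma pairing0 v : pairing 0 v = v i.
Proof.
rewrite -(@sum_delta R N i v iN); apply: eq_bigr => j _.
by rewrite w0 eq_sym.
Qed.

Lemma pairing_step k (v : nat -> R) :
  pairing k v - pairing k.+1 v =
  \sum_(j < N) w k j * (v j - \sum_(l < N) Q j l * v l).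
Proof.
under [RHS]eq_bigr do rewrite mulrBr.
rewrite sumrB; congr (_ - _).
under [RHS]eq_bigr do rewrite mulr_sumr.
rewrite exchange_big /=; apply: eq_bigr => l _.
by rewrite wS mulr_suml; apply: eq_bigr => j _; rewrite mulrA.
Qed.

(** Dynkin's formula for the killed chain: [pairing k v] is the expectation of [v] at step [k] over
    the states below [N]. *)
Lemma pairing_telescope n (v : nat -> R) :
  \sum_(0 <= k < n) \sum_(j < N) w k j * (v j - \sum_(l < N) Q j l * v l) =
  v i - pairing n v.
Proof.
under eq_bigr do rewrite -pairing_step.
elim: n => [|n IH]; first by rewrite big_geq // pairing0 subrr.
by rewrite big_nat_recr //= IH; ring.
Qed.

Variables (dl eta : R) (g u t : nat -> R).
Hypothesis dl0 : 0 < dl.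
Hypothesis eta2 : eta <= 1 / 2.
Hypothesis eta0 : 0 <= eta.
Hypothesis t_ge0 : forall j, 0 <= t j.
Hypothesis t_poisson : forall j, (j < N)%N ->
  `|t j - \sum_(l < N) Q j l * t l - dl| <= dl * eta.
Hypothesis u_poisson : forall j, (j < N)%N ->
  `|u j - \sum_(l < N) Q j l * u l - dl * g j| <= dl * eta.

Lemma pairing_ge0 k v : (forall j, 0 <= v j) -> 0 <= pairing k v.
Proof. by move=> v0; apply: sumr_ge0 => j _; rewrite mulr_ge0. Qed.

(** Since [eta <= 1 / 2], each step makes [t] decrease on average by at least [dl / 2] per unit of
    mass, and the total decrease is at most [t i]. *)
Lemma occupation_le n : \sum_(0 <= k < n) dl * \sum_(j < N) w k j <= 2 * t i.
Proof.
suff : \sum_(0 <= k < n) dl * \sum_(j < N) w k j <= 2 * (t i - pairing n t).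
  by move/le_trans; apply; have := pairing_ge0 n t_ge0; lra.
rewrite -pairing_telescope mulr_sumr; apply: ler_sum => k _.
rewrite !mulr_sumr; apply: ler_sum => j _.
rewrite mulrC mulrCA ler_wpM2l //.
have := t_poisson (ltn_ord j); rewrite ler_norml => /andP[+ _].
have : dl * eta <= dl * (1 / 2) by rewrite ler_wpM2l // ltW.
by lra.
Qed.

(** The masses are nonnegative with bounded partial sums, hence form a convergent series. *)
Lemma mass_cvg0 : \sum_(j < N) w k j @[k --> \oo] --> (0 : R).
Proof.
have mass_ge0 k : 0 <= \sum_(j < N) w k j by exact: sumr_ge0.
have : cvgn (series (fun k => dl * \sum_(j < N) w k j)).
  apply: nondecreasing_is_cvgn.
    apply: nondecreasing_series => k _ _.
    by rewrite mulr_ge0 // ltW.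
  exists (2 * t i) => _ [n _ <-]; exact: occupation_le.
move=> /cvg_series_cvg_0 h.
have -> : (fun k => \sum_(j < N) w k j) =
    (fun k => dl^-1 * (dl * \sum_(j < N) w k j)).
  by apply/funext => k; rewrite mulKf // gt_eqF.
have := cvgM (cvg_cst dl^-1) h; rewrite mulr0; exact.
Qed.

Lemma pairing_cvg0 v : pairing k v @[k --> \oo] --> (0 : R).
Proof.
pose C := \sum_(j < N) `|v j|.
apply: norm_cvg0; apply: (@squeeze_cvgr _ _ _ _ (fun=> 0)
    (fun k => (\sum_(j < N) w k j) * C)); last 2 first.
- exact: cvg_cst.
- by have := cvgM mass_cvg0 (cvg_cst C); rewrite mul0r; exact.
near=> k; rewrite normr_ge0 /= /pairing mulr_suml.
apply: le_trans (ler_norm_sum _ _ _) _; apply: ler_sum => j _.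
rewrite normrM ger0_norm // ler_wpM2l // /C (bigD1 j) //= lerDl.
by apply: sumr_ge0.
Unshelve. all: by end_near. Qed.

(** After telescoping, step [k] contributes an error of at most [dl * eta] per unit of mass; summing
    gives [eta] times the occupation time. *)
Lemma partial_cost n :
  `|\sum_(0 <= k < n) dl * pairing k g - (u i - pairing n u)| <=
  eta * (2 * t i).
Proof.
apply: le_trans (_ : eta * \sum_(0 <= k < n) dl * \sum_(j < N) w k j <= _);
  last by rewrite ler_wpM2l // occupation_le.
rewrite -pairing_telescope -sumrB mulr_sumr.
apply: le_trans (ler_norm_sum _ _ _) _; apply: ler_sum => k _.
rewrite /pairing mulr_sumr -sumrB !mulr_sumr.
apply: le_trans (ler_norm_sum _ _ _) _; apply: ler_sum => j _.
rewrite (mulrCA dl) -mulrBr normrM ger0_norm // distrC.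
by rewrite [leRHS]mulrA mulrC (mulrC eta) ler_wpM2r // u_poisson.
Qed.

Hypothesis g_ge0 : forall j, 0 <= g j.

(** Costs are read at step [k.+1] because the continuous-time cost will be sampled at the following
    grid point. The omitted initial term is [dl * g i], which accounts for the second error. *)
Lemma total_cost : exists S, [/\
  series (fun k => dl * pairing k.+1 g) @ \oo --> S &
  `|S - u i| <= eta * (2 * t i) + dl * g i].
Proof.
pose s n := \sum_(0 <= k < n) dl * pairing k g.
have pl : forall n, `|s n - (u i - pairing n u)| <= eta * (2 * t i) := partial_cost.
have cs : cvgn s.
  apply: nondecreasing_is_cvgn.
    apply: nondecreasing_series => k _ _.
    by rewrite mulr_ge0 ?(ltW dl0) ?pairing_ge0.
  pose G := \sum_(j < N) g j.
  exists (G * (2 * t i)) => _ [n _ <-].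
  apply: le_trans (_ : G * \sum_(0 <= k < n) dl * \sum_(j < N) w k j <= _);
    last by rewrite ler_wpM2l ?occupation_le // sumr_ge0.
  rewrite mulr_sumr; apply: ler_sum => k _.
  rewrite mulrCA ler_wpM2l ?(ltW dl0) // mulr_sumr; apply: ler_sum => j _.
  by rewrite mulrC ler_wpM2r // /G (bigD1 j) //= lerDl sumr_ge0.
exists (limn s - dl * g i); split.
  have -> : series (fun k => dl * pairing k.+1 g) = (fun n => s n.+1 - dl * g i).
    apply/funext => n; rewrite /s big_nat_recl //= pairing0 addrC addKr.
    by [].
  apply: cvgB; last exact: cvg_cst.
  by rewrite (cvg_shiftS s).
rewrite addrAC; apply: le_trans (ler_normB _ _) _; rewrite lerD //; last first.
  by rewrite ger0_norm // mulr_ge0 // ltW.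
(* Let [n] go to infinity in [partial_cost]; the remainder [pairing n u] vanishes with the mass. *)
have : `|s n - (u i - pairing n u)| @[n --> \oo] --> `|limn s - (u i - 0)|.
  apply: cvg_norm; apply: cvgB => //; apply: cvgB; first exact: cvg_cst.
  exact: pairing_cvg0.
rewrite subr0 => h; rewrite -(cvg_lim _ h) //.
apply: limr_le; first by apply/cvg_ex; eexists; exact: h.
by near=> n.
Unshelve. all: by end_near. Qed.

End killed_chain.

Lemma near_forall_lt (T : Type) (F : set_system T) (FF : Filter F) (N : nat)
    (Q : nat -> T -> Prop) :
  (forall j, (j < N)%N -> \forall x \near F, Q j x) ->
  \forall x \near F, forall j, (j < N)%N -> Q j x.
Proof.
elim: N => [|N IH] H; first by apply: nearW.
have h1 := H N (ltnSn N).
have h2 := IH (fun j jN => H j (leqW jN)).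
near=> x => j; rewrite ltnS leq_eqVlt => /predU1P[->|jN].
  by near: x.
by move: j jN; near: x.
Unshelve. all: by end_near. Qed.

(** * The skeleton of the chain on a dyadic grid *)

Section skeleton.
Variables (R : realType) (d : measure_display) (Omega : measurableType d).
Variables (P : nat -> probability Omega R) (X : R -> Omega -> nat).
Variables (lam mu : nat -> R).
Hypothesis chainX : birth_death_chain lam mu P X.

Definition pr i (A : set Omega) : R := fine (P i A).

Lemma prE i A : measurable A -> (pr i A)%:E = P i A.
Proof. by move=> mA; rewrite fineK // fin_num_measure. Qed.

Lemma pr_ge0 i A : 0 <= pr i A.
Proof. exact: fine_ge0. Qed.

Lemma measurable_state_pred t (K : pred nat) : 0 <= t ->
  measurable [set w | K (X t w)].
Proof.
move=> t0; have -> : [set w | K (X t w)] =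
    \bigcup_(j in [set j | K j]) [set w | X t w = j].
  by apply/seteqP; split => [w /= Kw|w /= [j Kj ->]] //; exists (X t w).
by apply: bigcup_measurable => j _; exact: (bdc_measurable chainX).
Qed.

Definition alive_set (K : pred nat) m n : set Omega :=
  [set w | alive (X^~ w) K m n].

Lemma alive_setS K m n : alive_set K m n.+1 =
  alive_set K m n `&` [set w | K (X (grid R m n) w)].
Proof.
by apply/seteqP; split => w; rewrite /alive_set /= aliveS => /andP.
Qed.

Lemma measurable_alive_set K m n : measurable (alive_set K m n).
Proof.
elim: n => [|n IH].
  rewrite (_ : alive_set _ _ _ = setT) //.
  by apply/seteqP; split.
rewrite alive_setS; apply: measurableI => //.
by apply: measurable_state_pred; exact: grid_ge0.
Qed.

Lemma pr_split i (A : set Omega) t N : measurable A -> 0 <= t ->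
  pr i (A `&` [set w | (X t w < N)%N]) =
  \sum_(a < N) pr i (A `&` [set w | X t w = a]).
Proof.
move=> mA t0; elim: N => [|N IH].
  rewrite big_ord0 (_ : _ `&` _ = set0) ?/pr ?measure0 //.
  by apply/seteqP; split => w [].
rewrite big_ord_recr /= -IH.
have -> : A `&` [set w | (X t w < N.+1)%N] =
    (A `&` [set w | (X t w < N)%N]) `|` (A `&` [set w | X t w = N]).
  rewrite -setIUr; congr (_ `&` _); apply/seteqP; split => w /=.
    by rewrite ltnS leq_eqVlt => /predU1P[->|]; [right | left].
  by case => [/leqW //|->].
have m1 : measurable (A `&` [set w | (X t w < N)%N]).
  by apply: measurableI => //; exact: (measurable_state_pred (fun n => (n < N)%N)).
have m2 : measurable (A `&` [set w | X t w = N]).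
  by apply: measurableI => //; exact: (bdc_measurable chainX).
apply: EFin_inj; rewrite EFinD !prE //; last exact: measurableU.
rewrite measureU //; apply/seteqP; split => w //= [[_ wN] [_ wN']].
by rewrite wN' ltnn in wN.
Qed.

(** Only the points before index [k] are tested, so [j] may be [N] or larger: the mass leaving
    [{n | n < N}] at step [k] remains visible. *)
Definition skeleton_law i N m k j : R :=
  pr i (alive_set (fun n => (n < N)%N) m k `&` [set w | X (grid R m k) w = j]).

Definition skeleton_step m j l : R := pr j [set w | X (grid R m 1) w = l].

Lemma grid_addS m k : grid R m k.+1 = grid R m k + grid R m 1.
Proof. by rewrite /grid -mulrDl -natr1. Qed.

Lemma measurable_past (past : seq (R * nat)) :
  (forall q, q \in past -> 0 <= q.1) ->
  measurable [set w | forall q, q \in past -> X q.1 w = q.2].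
Proof.
move=> hp; rewrite (_ : [set w | _] =
    \bigcap_(q in [set` past]) [set w | X q.1 w = q.2]).
  apply: fin_bigcap_measurable => // q /= /hp q0.
  exact: (bdc_measurable chainX).
by apply/seteqP; split => w H q; exact: H.
Qed.

(** [bdc_markov] conditions on exact past values, whereas survival only bounds them. The induction
    removes one survival test at a time, splitting on the state [a < N] at that point and adding it
    to [past]. *)
Lemma skeleton_markov i N m n k j l (past : seq (R * nat)) : (n <= k)%N ->
  (forall q, q \in past -> 0 <= q.1 <= grid R m k) ->
  let A := [set w | forall q, q \in past -> X q.1 w = q.2]
           `&` alive_set (fun n => (n < N)%N) m n in
  pr i (A `&` [set w | X (grid R m k) w = j]
          `&` [set w | X (grid R m k.+1) w = l]) =
  pr i (A `&` [set w | X (grid R m k) w = j]) * skeleton_step m j l.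
Proof.
elim: n past => [|n IH] past nk hp /=.
  rewrite (_ : alive_set _ _ _ = setT); last by apply/seteqP; split.
  rewrite setIT grid_addS /skeleton_step /pr (bdc_markov chainX) ?grid_ge0 //.
  rewrite fineM // ?fin_num_measure //; last first.
    by apply: (bdc_measurable chainX); exact: grid_ge0.
  apply: measurableI; last by apply: (bdc_measurable chainX); exact: grid_ge0.
  by apply: measurable_past => q /hp /andP[].
pose past' (a : nat) := (grid R m n, a) :: past.
pose Ap a := [set w | forall q, q \in past' a -> X q.1 w = q.2].
pose A0 := [set w | forall q, q \in past -> X q.1 w = q.2].
have mA0 : measurable A0.
  by apply: measurable_past => q /hp /andP[].
have key B : measurable B ->
    pr i (A0 `&` alive_set (fun n => (n < N)%N) m n.+1 `&` B) =
    \sum_(a < N) pr i (Ap a `&` alive_set (fun n => (n < N)%N) m n `&` B).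
  move=> mB; rewrite alive_setS setIA setIAC pr_split ?grid_ge0 //; last first.
    apply: measurableI => //; apply: measurableI => //.
    exact: measurable_alive_set.
  apply: eq_bigr => a _; congr pr; apply/seteqP; split => w /=.
    move=> [[[h0 h1] h2] h3]; split => //; split => // q.
    by rewrite inE => /predU1P[-> //|]; exact: h0.
  move=> [[h0 h1] h2]; split; last by apply: (h0 (_, _)); rewrite inE eqxx.
  by do 2 split => //; move=> q qp; apply: h0; rewrite inE qp orbT.
have mk : measurable [set w | X (grid R m k) w = j].
  by apply: (bdc_measurable chainX); exact: grid_ge0.
rewrite -setIA !key //; last first.
  by apply: measurableI => //; apply: (bdc_measurable chainX); exact: grid_ge0.
rewrite mulr_suml; apply: eq_bigr => a _.
rewrite setIA; apply: IH; first exact: ltnW.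
move=> q; rewrite inE => /predU1P[-> /=|]; last exact: hp.
by rewrite grid_ge0 ler_grid // ltnW.
Qed.

Lemma skeleton_law_ge0 i N m k j : 0 <= skeleton_law i N m k j.
Proof. exact: pr_ge0. Qed.

Lemma skeleton_law0 i N m j : skeleton_law i N m 0 j = (i == j)%:R.
Proof.
have g0 : grid R m 0 = 0 by rewrite /grid mul0r.
have := bdc_init chainX i.
have m0 (a : nat) : measurable [set w | X 0 w = a].
  exact: (bdc_measurable chainX).
rewrite /skeleton_law g0 (_ : alive_set _ _ _ = setT); last first.
  by apply/seteqP; split.
rewrite setTI /pr => Pi; have [<-|ij] := eqVneq i j; first by rewrite Pi.
(* The disjoint event [X 0 = i] already has mass [1]. *)
suff -> : P i [set w | X 0 w = j] = 0%E by [].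
apply/eqP; rewrite eq_le measure_ge0 andbT.
have : (P i ([set w | X 0 w = i] `|` [set w | X 0 w = j]) <= 1)%E.
  by apply: probability_le1; exact: measurableU.
have -> : P i ([set w | X 0 w = i] `|` [set w | X 0 w = j]) =
    (P i [set w | X 0 w = i] + P i [set w | X 0 w = j])%E.
  apply: measureU => //; apply/seteqP; split => w //= [-> /eqP].
  by rewrite (negbTE ij).
by rewrite Pi -[leRHS]adde0 leeD2lE.
Qed.

Lemma skeleton_lawS i N m k l : skeleton_law i N m k.+1 l =
  \sum_(a < N) skeleton_law i N m k a * skeleton_step m a l.
Proof.
rewrite /skeleton_law alive_setS setIAC pr_split ?grid_ge0 //; last first.
  apply: measurableI; first exact: measurable_alive_set.
  by apply: (bdc_measurable chainX); exact: grid_ge0.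
apply: eq_bigr => a _; rewrite setIAC.
have := @skeleton_markov i N m k k a l [::] (leqnn k) (fun q qn => ltac:(by [])).
rewrite /= (_ : [set w | forall q, q \in [::] -> X q.1 w = q.2] = setT).
  by rewrite setTI.
by apply/seteqP; split.
Qed.

Lemma skeleton_rate j l :
  (skeleton_step m j l - (j == l)%:R) / grid R m 1 @[m --> \oo]
    --> generator lam mu j l.
Proof.
have -> : (fun m => (skeleton_step m j l - (j == l)%:R) / grid R m 1) =
  (fun h => (fine (P j [set w | X h w = l]) - (j == l)%:R) / h) \o
    (fun m => (2 ^+ m)^-1).
  by apply/funext => m; rewrite /skeleton_step /pr /grid /= mul1r.
exact: cvg_comp (@mesh_cvg0r R) (@bdc_rates _ _ _ _ _ _ _ chainX j l).
Qed.

Lemma skeleton_rate_sum N j (v : nat -> R) : (j < N)%N ->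
  (\sum_(l < N) skeleton_step m j l * v l - v j) / grid R m 1 @[m --> \oo]
    --> \sum_(l < N) generator lam mu j l * v l.
Proof.
move=> jN.
have -> : (fun m => (\sum_(l < N) skeleton_step m j l * v l - v j) / grid R m 1) =
    (fun m => \sum_(l < N) (skeleton_step m j l - (j == l)%:R) / grid R m 1 * v l).
  apply/funext => m; rewrite -(@sum_delta _ _ _ v jN) -sumrB mulr_suml.
  by apply: eq_bigr => l _; rewrite (eq_sym j); ring.
elim: (index_enum _) => [|l r IH].
  by rewrite big_nil; under eq_fun do rewrite big_nil; exact: cvg_cst.
rewrite big_cons; under eq_fun do rewrite big_cons.
apply: cvgD IH.
by have := cvgM (@skeleton_rate j l) (cvg_cst (v l)); exact.
Qed.

Hypothesis lam_gt0 : forall n, 0 < lam n.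
Hypothesis mu0 : mu 0%N = 0.

(** The rates give the generator summed over [N.+1] states; the boundary value [u N = 0] removes the
    last one, leaving exactly the killed matrix. *)
Lemma skeleton_poisson N (g : nat -> R) eta : 0 < eta ->
  let u j := path_cost lam mu g j N in
  \forall m \near \oo, forall j, (j < N)%N ->
    `|u j - \sum_(l < N) skeleton_step m j l * u l - grid R m 1 * g j| <=
    grid R m 1 * eta.
Proof.
move=> eta0 u; apply: near_forall_lt => j jN.
have := @skeleton_rate_sum N.+1 j u (leqW jN).
rewrite (@generator_path_cost _ _ _ lam_gt0 mu0 N g j jN).
move=> /cvgr_dist_le /(_ _ eta0); apply: filterS => m.
have uN : u N = 0 by exact: path_cost_id.
have dl0 : 0 < grid R m 1 by rewrite divr_gt0 ?expr2n_gt0.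
rewrite big_ord_recr /= uN mulr0 addr0 => h.
rewrite -(ler_pM2l dl0) -[X in X * `|_|](gtr0_norm dl0) -normrM in h.
apply: le_trans h; rewrite le_eqVlt; apply/orP; left; apply/eqP; congr `|_|.
by field; rewrite gt_eqF.
Qed.

(** From [j < N] the generator charges no state above [N], so its row over [N.+1] states sums to [0]
    and a jump over [N] within one mesh has probability [o(2^-m)]. *)
Lemma skeleton_escape N eta : 0 < eta ->
  \forall m \near \oo, forall j, (j < N)%N ->
    1 - \sum_(l < N.+1) skeleton_step m j l <= grid R m 1 * eta.
Proof.
move=> eta0; apply: near_forall_lt => j jN.
have := @skeleton_rate_sum N.+1 j (fun=> 1) (leqW jN).
under [X in _ --> X]eq_bigr do rewrite mulr1.
rewrite (@generator_sum0 _ _ _ mu0 N j jN).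
move=> /cvgr_dist_le /(_ _ eta0); apply: filterS => m.
have dl0 : 0 < grid R m 1 by rewrite divr_gt0 ?expr2n_gt0.
under eq_bigr do rewrite mulr1.
rewrite sub0r -mulNr opprB => /(le_trans (ler_norm _)).
by rewrite ler_pdivrMr // mulrC.
Qed.

Lemma pr_alive i N m k : pr i (alive_set (fun n => (n < N)%N) m k.+1) =
  \sum_(j < N) skeleton_law i N m k j.
Proof.
rewrite alive_setS pr_split ?grid_ge0 //; exact: measurable_alive_set.
Qed.

Definition jump_set N m : set Omega := [set w | exists k,
  alive (X^~ w) (fun n => (n < N)%N) m k.+1 /\ (N < X (grid R m k.+1) w)%N].

Let jump_at N m k : set Omega := alive_set (fun n => (n < N)%N) m k.+1
  `&` [set w | (N < X (grid R m k.+1) w)%N].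

Let measurable_jump_at N m k : measurable (jump_at N m k).
Proof.
apply: measurableI; first exact: measurable_alive_set.
by apply: (measurable_state_pred (fun n => (N < n)%N)); exact: grid_ge0.
Qed.

Let jump_setE N m : jump_set N m = \bigcup_k jump_at N m k.
Proof. by apply/seteqP; split => [w [k h]|w [k _ h]]; exists k. Qed.

Lemma measurable_jump_set N m : measurable (jump_set N m).
Proof. by rewrite jump_setE; exact: bigcup_measurable. Qed.

(** Mass balance: a path alive through point [k] is at point [k.+1] either above [N] or among the
    [N.+1] states up to [N]. *)
Let pr_jump_at i N m k : pr i (jump_at N m k) =
  \sum_(j < N) skeleton_law i N m k j * (1 - \sum_(l < N.+1) skeleton_step m j l).
Proof.
have mA := measurable_alive_set (fun n => (n < N)%N) m k.+1.
have : pr i (alive_set (fun n => (n < N)%N) m k.+1) =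
    pr i (jump_at N m k) + pr i (alive_set (fun n => (n < N)%N) m k.+1
      `&` [set w | (X (grid R m k.+1) w < N.+1)%N]).
  have mB := measurable_jump_at N m k.
  have mC : measurable (alive_set (fun n => (n < N)%N) m k.+1
      `&` [set w | (X (grid R m k.+1) w < N.+1)%N]).
    apply: measurableI => //.
    by apply: (measurable_state_pred (fun n => (n < N.+1)%N)); exact: grid_ge0.
  apply: EFin_inj; rewrite EFinD !prE // -measureU //.
    congr (P i _); rewrite -setIUr; apply/seteqP; split => w /=; last by case.
    by move=> aw; split => //; rewrite ltnS; case: ltnP; [left|right].
  apply/seteqP; split => w //= [[_ /= h1] [_ /=]].
  by rewrite ltnS leqNgt h1.
rewrite pr_alive pr_split ?grid_ge0 // => h.
have -> : pr i (jump_at N m k) = \sum_(j < N) skeleton_law i N m k j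
    - \sum_(l < N.+1) skeleton_law i N m k.+1 l by rewrite h addrK.
under [RHS]eq_bigr do rewrite mulrBr mulr1.
rewrite sumrB; congr (_ - _).
under eq_bigr do rewrite skeleton_lawS.
by rewrite exchange_big; apply: eq_bigr => j _; rewrite mulr_sumr.
Qed.

Hypothesis mu_gt0 : forall n, (1 <= n)%N -> 0 < mu n.

Lemma skeleton_occupation i N : (i < N)%N ->
  \forall m \near \oo, forall n,
    \sum_(0 <= k < n) grid R m 1 * \sum_(j < N) skeleton_law i N m k j <=
    2 * path_cost lam mu (fun=> 1) i N.
Proof.
move=> iN; have half : 0 < 1 / 2 :> R by lra.
have := skeleton_poisson N (fun=> 1) half; apply: filterS => m hm n.
apply: (@occupation_le _ _ _ (skeleton_step m) _ iN _ _ _ (grid R m 1) (1 / 2)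
  (fun j => path_cost lam mu (fun=> 1) j N)) => //.
- by move=> *; exact: skeleton_law_ge0.
- by move=> *; exact: skeleton_law0.
- by move=> *; exact: skeleton_lawS.
- by rewrite divr_gt0 ?expr2n_gt0.
- by move=> j; apply: path_cost_ge0.
- by move=> j jN; have := hm j jN; rewrite mulr1.
Qed.

(** Union bound over the step of the jump: each step costs [eta] times the mesh per unit of mass,
    and the mesh times the total mass is the bounded occupation time. *)
Lemma jump_set_cvg0 i N eta : (i < N)%N -> 0 < eta ->
  \forall m \near \oo,
    (P i (jump_set N m) <= (eta * (2 * path_cost lam mu (fun=> 1) i N))%:E)%E.
Proof.
move=> iN eta0.
near=> m; have esc : forall j, (j < N)%N ->
    1 - \sum_(l < N.+1) skeleton_step m j l <= grid R m 1 * eta.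
  by near: m; exact: skeleton_escape.
have occ : forall n, \sum_(0 <= k < n) grid R m 1 *
    \sum_(j < N) skeleton_law i N m k j <=
    2 * path_cost lam mu (fun=> 1) i N.
  by near: m; exact: skeleton_occupation.
rewrite jump_setE.
apply: (@le_trans _ _ (\sum_(0 <= k <oo) P i (jump_at N m k))%E).
  apply: measure_sigma_subadditive => //.
  by rewrite -jump_setE; exact: measurable_jump_set.
apply: lime_le; first by apply: is_cvg_nneseries => k _ _; exact: measure_ge0.
apply: nearW => n; rewrite (eq_bigr (fun k => (pr i (jump_at N m k))%:E)).
  rewrite sumEFin lee_fin.
  apply: (@le_trans _ _ (eta * \sum_(0 <= k < n) grid R m 1 *
      \sum_(j < N) skeleton_law i N m k j)); last first.
    by rewrite ler_wpM2l ?(ltW eta0).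
  rewrite mulr_sumr; apply: ler_sum => k _; rewrite pr_jump_at !mulr_sumr.
  apply: ler_sum => j _; rewrite mulrA (mulrC eta) [leRHS]mulrC.
  by rewrite ler_wpM2l ?skeleton_law_ge0 ?esc.
by move=> k _; rewrite prE.
Unshelve. all: by end_near. Qed.

Lemma ae_no_jump i N : (i < N)%N ->
  {ae P i, forall w, X 0 w = i /\ ~ \forall m \near \oo, jump_set N m w}.
Proof.
move=> iN.
have m0 : measurable [set w | X 0 w = i] by exact: (bdc_measurable chainX).
have h0 : {ae P i, forall w, X 0 w = i}.
  exists (~` [set w | X 0 w = i]); split => //; first exact: measurableC.
  rewrite probability_setC // (bdc_init chainX) -EFinB subrr //.
have h1 : (P i).-negligible
    (\bigcup_M \bigcap_(m in [set m | (M <= m)%N]) jump_set N m).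
  apply: negligible_bigcup => M.
  pose B := \bigcap_(m in [set m | (M <= m)%N]) jump_set N m.
  have mB : measurable B.
    by apply: bigcap_measurableType => m _; exact: measurable_jump_set.
  exists B; split => //; apply/eqP; rewrite eq_le measure_ge0 andbT.
  apply/lee_addgt0Pr => e e0; rewrite add0e.
  pose T := 2 * path_cost lam mu (fun=> 1) i N.
  have T0 : 0 <= T by rewrite mulr_ge0 // path_cost_ge0.
  (* The denominator [T + 1] is positive even when [T = 0], and the resulting bound
     [e * T / (T + 1)] is at most [e]. *)
  have eT : 0 < e / (T + 1) by rewrite divr_gt0 // ltr_wpDl.
  have [M' _ hM'] := jump_set_cvg0 iN eT.
  pose m := maxn M M'.
  apply: (@le_trans _ _ (P i (jump_set N m))).
    apply: le_measure; rewrite ?inE //; first exact: measurable_jump_set.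
    by move=> w /(_ m); apply; rewrite /= leq_maxl.
  apply: le_trans (hM' m _) _; first by rewrite /= leq_maxr.
  rewrite lee_fin -/T mulrAC ler_pdivrMr ?ltr_wpDl //.
  by rewrite ler_wpM2l ?(ltW e0) // lerDl.
have h2 : {ae P i, forall w, ~ \forall m \near \oo, jump_set N m w}.
  apply: negligibleS h1 => w /= /contrapT [M _ HM].
  by exists M => // m Mm; exact: HM.
by apply: filterS2 h0 h2 => w hw0 hw2; split.
Qed.

End skeleton.

(** * Integration of grid step functions over sample space and time *)

Section grid_integral.
Variables (R : realType) (d : measure_display) (T : measurableType d).
Variable P : probability T R.
Local Notation leb := (@lebesgue_measure R).

(** Step function of time, equal to [V k] on the [k]-th cell; it is [0] at negative times because
    Lebesgue measure lives on the whole line. *)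
Definition grid_lift m (V : nat -> T -> \bar R) (z : T * R) : \bar R :=
  if 0 <= z.2 then V (grid_index m z.2) z.1 else 0%E.

Lemma grid_cellE m k : [set s : R | 0 <= s /\ grid_index m s = k] =
  [set` `[grid R m k, grid R m k.+1[].
Proof.
apply/seteqP; split => s /=; rewrite in_itv /=.
  by case=> s0 /eqP; rewrite grid_index_eq.
move=> sk; have s0 : 0 <= s by case/andP: sk => /(le_trans (grid_ge0 _ _ _)).
by split => //; apply/eqP; rewrite grid_index_eq.
Qed.

Lemma measurable_grid_cell m k :
  measurable [set s : R | 0 <= s /\ grid_index m s = k].
Proof. by rewrite grid_cellE; exact: measurable_itv. Qed.

Lemma measurable_grid_lift m (V : nat -> T -> \bar R) :
  (forall k, measurable_fun setT (V k)) ->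
  measurable_fun [set: T * measurableTypeR R] (grid_lift m V).
Proof.
move=> mV _ Y mY; rewrite setTI.
have -> : grid_lift m V @^-1` Y =
    \bigcup_k ((V k @^-1` Y) `*` [set s | 0 <= s /\ grid_index m s = k])
    `|` [set z | z.2 < 0 /\ Y 0%E].
  apply/seteqP; split => [[w s]|[w s]] /=; rewrite /grid_lift /=.
    by case: (lerP 0 s) => s0 Ys; [left; exists (grid_index m s) | right].
  case=> [[k _ [/= Vk [s0 sk]]]|[s0 Y0]]; first by rewrite s0 sk.
  by rewrite leNgt s0.
apply: measurableU.
  apply: bigcup_measurable => k _; apply: measurableX.
    by rewrite -[_ @^-1` _]setTI; exact: mV.
  exact: measurable_grid_cell.
have [Y0|Y0] := pselect (Y 0%E); last first.
  by rewrite (_ : [set z | _] = set0) //; apply/seteqP; split => z [].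
rewrite (_ : [set z | _] = setT `*` [set` `]-oo, 0[ ]).
  by apply: measurableX => //; exact: measurable_itv.
by apply/seteqP; split => -[w s] /=; rewrite in_itv /= => -[].
Qed.

Lemma grid_lift_ge0 m (V : nat -> T -> \bar R) z :
  (forall k w, 0 <= V k w)%E -> (0 <= grid_lift m V z)%E.
Proof. by move=> V0; rewrite /grid_lift; case: ifP. Qed.

Lemma integral_grid_step m (e : nat -> \bar R) : (forall k, 0 <= e k)%E ->
  (\int[leb]_s (if (0 <= s)%R then e (grid_index m s) else 0) =
   \sum_(0 <= k <oo) (grid R m 1)%:E * e k)%E.
Proof.
move=> e0.
pose F k := [set s : R | 0 <= s /\ grid_index m s = k].
have mF k : measurable (F k) := measurable_grid_cell m k.
have -> : (\int[leb]_s (if (0 <= s)%R then e (grid_index m s) else 0) =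
    \int[leb]_(s in \bigcup_k F k) e (grid_index m s))%E.
  rewrite [RHS]integral_mkcond; apply: eq_integral => s _ /=.
  rewrite patchE; case: ifPn => [s0|s0].
    by rewrite mem_set //; exists (grid_index m s).
  by rewrite memNset // => -[k _ [s0' _]]; rewrite s0' in s0.
rewrite (@ge0_integral_bigcup _ _ _ leb F) //.
- apply: eq_eseriesr => k _.
  rewrite (eq_integral (fun=> e k)); last by move=> s; rewrite inE => -[_ <-].
  rewrite integral_cst; last exact: mF.
  rewrite muleC; congr (_ * _)%E.
  have l1 : grid R m k < grid R m k.+1.
    by rewrite ltr_pM2r ?invr_gt0 ?expr2n_gt0 // ltr_nat.
  rewrite /F grid_cellE; apply: etrans (lebesgue_measure_itv _) _.
  by rewrite /= lte_fin l1 -EFinB /grid -mulrBl -natr1 addrAC subrr add0r.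
- move=> _ Y mY.
  rewrite (_ : _ `&` _ = \bigcup_(k in [set k | Y (e k)]) F k).
    by apply: bigcup_measurable => k _; exact: mF.
  apply/seteqP; split => s /=.
    by move=> [[k _ [s0 _]] Ye]; exists (grid_index m s).
  by move=> [k /= Yk [s0 sk]]; split; [exists k | rewrite sk].
- apply/trivIsetP => a b _ _ ab.
  by apply/seteqP; split => s //= [[_ sa] [_ sb]]; rewrite -sa -sb eqxx in ab.
Qed.

(** By Tonelli, integrating over the sample space first leaves a step function of time, hence a
    series of skeleton expectations. *)
Lemma integral_grid_lift m (V : nat -> T -> \bar R) :
  (forall k, measurable_fun setT (V k)) ->
  (forall k w, 0 <= V k w)%E ->
  (\int[P \x leb]_z grid_lift m V z =
   \sum_(0 <= k <oo) (grid R m 1)%:E * \int[P]_w V k w)%E.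
Proof.
move=> mV V0; rewrite fubini_tonelli2; last 2 first.
- exact: measurable_grid_lift.
- by move=> z; exact: grid_lift_ge0.
rewrite -integral_grid_step; last by move=> k; exact: integral_ge0.
apply: eq_integral => s _; rewrite /fubini_G /grid_lift /=.
by case: ifP => // _; rewrite integral0.
Qed.

End grid_integral.

(** * Expected passage costs in continuous time *)

Section survival_cost.
Variables (R : realType) (d : measure_display) (Omega : measurableType d).
Variables (P : nat -> probability Omega R) (X : R -> Omega -> nat).
Variables (lam mu : nat -> R).
Hypothesis chainX : birth_death_chain lam mu P X.
Hypothesis lam_gt0 : forall n, 0 < lam n.
Hypothesis mu_gt0 : forall n, (1 <= n)%N -> 0 < mu n.
Hypothesis mu0 : mu 0%N = 0.
Local Notation leb := (@lebesgue_measure R).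

Let X_rc w : forall t, 0 <= t -> \forall s \near t^'+, X s w = X t w.
Proof. exact: (bdc_right_continuous chainX w). Qed.

(** [K] is kept general because two stopping rules are compared: leaving [{n | n < N}] and hitting
    [N]. *)
Definition survival_cost (K : pred nat) (g : nat -> R) (z : Omega * R) : \bar R :=
  if 0 <= z.2 then
    (if `[< survives (X^~ z.1) K z.2 >] then g (X z.2 z.1) else 0)%:E
  else 0%E.

Definition alive_cost (K : pred nat) (g : nat -> R) m n w : \bar R :=
  (if alive (X^~ w) K m n.+1 then g (X (grid R m n) w) else 0)%:E.

Lemma alive_cost_ge0 K g m n w : (forall j, 0 <= g j) ->
  (0 <= alive_cost K g m n w)%E.
Proof. by move=> g0; rewrite lee_fin; case: ifP. Qed.

Lemma measurable_alive_cost K g m n : measurable_fun setT (alive_cost K g m n).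
Proof.
apply/measurable_EFinP; apply: measurable_fun_ifT.
- apply: (measurable_fun_bool true); rewrite setTI.
  exact: (measurable_alive_set chainX K m n.+1).
- move=> _ Y _; rewrite setTI.
  have := measurable_state_pred chainX (fun j => `[< Y (g j) >]) (grid_ge0 R m n).
  by congr measurable; apply/seteqP; split => w /= /asboolP.
- exact: measurable_cst.
Qed.

Lemma survival_cost_ge0 K g z : (forall j, 0 <= g j) ->
  (0 <= survival_cost K g z)%E.
Proof.
move=> g0; rewrite /survival_cost; case: ifP => // _.
by rewrite lee_fin; case: ifP.
Qed.

Lemma survival_cost_cvg K g z :
  grid_lift m (fun n => alive_cost K g m n.+1) z @[m --> \oo]
    --> survival_cost K g z.
Proof.
case: z => w s; rewrite /survival_cost /grid_lift /=.
case: ifPn => [s0|_]; last exact: cvg_cst.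
apply: cvg_near_cst; near=> m; rewrite /alive_cost.
have -> : alive (X^~ w) K m (grid_index m s).+2 =
    `[< survives (X^~ w) K s >].
  by near: m; exact: (alive_cvg (X_rc w)).
suff -> : X (grid R m (grid_index m s).+1) w = X s w by [].
by near: m; exact: (next_grid_cvg (X_rc w)).
Unshelve. all: by end_near. Qed.

Lemma measurable_survival_cost K g :
  measurable_fun [set: Omega * measurableTypeR R] (survival_cost K g).
Proof.
apply: (emeasurable_fun_cvg
  (fun m => grid_lift m (fun n => alive_cost K g m n.+1))).
  by move=> m; apply: measurable_grid_lift => k; exact: measurable_alive_cost.
by move=> z _; exact: survival_cost_cvg.
Qed.

Section start.
Variables (i N : nat).
Hypothesis iN : (i < N)%N.
Let K : pred nat := fun n => (n < N)%N.

Lemma integral_alive_cost g m n : (forall j, 0 <= g j) ->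
  (\int[P i]_w alive_cost K g m n w =
   (\sum_(j < N) skeleton_law P X i N m n j * g j)%:E)%E.
Proof.
move=> g0; pose A j := alive_set X K m n `&` [set w | X (grid R m n) w = j].
have mA j : measurable (A j).
  apply: measurableI; first exact: (measurable_alive_set chainX).
  by apply: (bdc_measurable chainX); exact: grid_ge0.
have -> : alive_cost K g m n =
    (fun w => \sum_(j < N) (g j)%:E * (\1_(A j) w)%:E)%E.
  apply/funext => w; rewrite /alive_cost aliveS.
  under eq_bigr do rewrite -EFinM.
  rewrite sumEFin; congr EFin; case: ifPn => [/andP[Aw Kw]|nA].
    rewrite (bigD1 (Ordinal Kw)) //= indicE mem_set // mulr1.
    rewrite big1 ?addr0 // => j /eqP nj.
    rewrite indicE memNset ?mulr0 // => -[_ /= Xj].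
    by apply: nj; apply/val_inj; rewrite /= -Xj.
  rewrite big1 // => j _; rewrite indicE memNset ?mulr0 // => -[Aw /= Xj].
  by move: nA; rewrite Aw Xj /K ltn_ord.
rewrite ge0_integral_sum //; last 2 first.
- move=> j; apply: measurable_funeM; apply/measurable_EFinP.
  exact: measurable_indic.
- by move=> j w _; rewrite mule_ge0 // lee_fin.
rewrite -sumEFin; apply: eq_bigr => j _.
rewrite ge0_integralZl_EFin //; last first.
  by apply/measurable_EFinP; exact: measurable_indic.
rewrite integral_indic // setIT muleC EFinM; congr (_ * _)%E.
by rewrite /skeleton_law prE //; exact: mA.
Qed.

(** While alive the state is below [N], so the sum of the [g j] bounds the rate; [alive_domination]
    moves the survival test to the fixed coarse grid. *)
Lemma alive_cost_dominated g m k z : (forall j, 0 <= g j) ->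
  (`|grid_lift (k + m) (fun n => alive_cost K g (k + m) n.+1) z| <=
   grid_lift m (alive_cost K (fun=> \sum_(j < N) g j)%R m) z)%E.
Proof.
move=> g0; case: z => w s; rewrite /grid_lift /=.
case: ifPn => [s0|_]; last by rewrite abse0.
rewrite gee0_abs ?alive_cost_ge0 // lee_fin.
case: ifPn => [Aw|_]; last by case: ifP => // _; exact: sumr_ge0.
rewrite (alive_domination s0 Aw).
move/aliveP : Aw => /(_ _ (ltnSn _)) Kx.
by rewrite (bigD1 (Ordinal Kx)) //= lerDl sumr_ge0.
Qed.

(** The integral is [C] times the expected skeleton occupation time, which is bounded on all fine
    grids. *)
Lemma integrable_dominating C : 0 <= C -> \forall m \near \oo,
  (P i \x leb)%E.-integrable setT (grid_lift m (alive_cost K (fun=> C) m)).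
Proof.
move=> C0; have := skeleton_occupation chainX lam_gt0 mu0 mu_gt0 iN.
apply: filterS => m hm; apply/integrableP; split.
  by apply: measurable_grid_lift => k; exact: measurable_alive_cost.
have lift_ge0 z : (0 <= grid_lift m (alive_cost K (fun=> C) m) z)%E.
  by apply: grid_lift_ge0 => k w; exact: alive_cost_ge0.
under eq_integral do rewrite gee0_abs //.
rewrite integral_grid_lift; last 2 first.
- by move=> k; exact: measurable_alive_cost.
- by move=> k w; exact: alive_cost_ge0.
under eq_eseriesr do rewrite integral_alive_cost //.
apply: (@le_lt_trans _ _ (C * (2 * path_cost lam mu (fun=> 1) i N))%:E);
  last exact: ltry.
apply: lime_le.
  apply: is_cvg_nneseries => k _ _; rewrite mule_ge0 // lee_fin ?grid_ge0 //.
  by apply: sumr_ge0 => j _; rewrite mulr_ge0 // skeleton_law_ge0.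
apply: nearW => n; under eq_bigr do rewrite -EFinM -mulr_suml.
rewrite sumEFin lee_fin.
under eq_bigr do rewrite mulrA.
by rewrite -mulr_suml mulrC ler_wpM2l.
Qed.

Lemma integral_skeleton_cost_cvg g : (forall j, 0 <= g j) ->
  (\int[P i \x leb]_z grid_lift m (fun n => alive_cost K g m n.+1) z)%E
    @[m --> \oo] --> (path_cost lam mu g i N)%:E.
Proof.
move=> g0; pose T := 2 * path_cost lam mu (fun=> 1) i N.
have T0 : 0 <= T by rewrite mulr_ge0 // path_cost_ge0.
(* The integral is the series of [total_cost], with [path_cost] as near-solution of Poisson's
   equation for both [g] and [1]. *)
have near_cost eta : 0 < eta -> eta <= 1 / 2 -> \forall m \near \oo, exists2 S,
    (\int[P i \x leb]_z grid_lift m (fun n => alive_cost K g m n.+1) z = S%:E)%E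
    & `|S - path_cost lam mu g i N| <= eta * T + grid R m 1 * g i.
  move=> eta0 eta2.
  have h1 := skeleton_poisson chainX lam_gt0 mu0 N g eta0.
  have h2 := skeleton_poisson chainX lam_gt0 mu0 N (fun=> 1) eta0.
  apply: filterS2 h1 h2 => m h1 h2.
  have [||||||||||S [cS bS]] := @total_cost R N i (skeleton_step P X m)
    (skeleton_law P X i N m) iN _ _ _ (grid R m 1) eta g
    (fun j => path_cost lam mu g j N) (fun j => path_cost lam mu (fun=> 1) j N).
  - by move=> *; exact: skeleton_law_ge0.
  - by move=> *; exact: (skeleton_law0 chainX).
  - by move=> *; exact: (skeleton_lawS chainX).
  - by rewrite divr_gt0 ?expr2n_gt0.
  - exact: eta2.
  - exact: ltW.
  - by move=> j; apply: path_cost_ge0.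
  - by move=> j jN; have := h2 j jN; rewrite mulr1.
  - exact: h1.
  - exact: g0.
  exists S => //; rewrite integral_grid_lift; last 2 first.
  - by move=> k; exact: measurable_alive_cost.
  - by move=> k w; exact: alive_cost_ge0.
  under eq_eseriesr do rewrite integral_alive_cost // -EFinM.
  apply/cvg_lim => //.
  rewrite (_ : (fun n => _) = EFin \o
    series (fun k => grid R m 1 *
      \sum_(j < N) skeleton_law P X i N m k.+1 j * g j)).
    by apply: cvg_EFin => //; exact: nearW.
  by apply/funext => n; rewrite /= sumEFin.
apply/fine_cvgP; split.
  have := near_cost (1 / 2) ltac:(lra) (lexx _).
  by apply: filterS => m [S -> _].
apply/cvgrPdist_le => e e0.
(* The first bound is required by [total_cost]; the second makes [eta * T] at most [e / 2], leaving
   [e / 2] for the initial term. *)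
pose eta := Num.min (1 / 2) (e / 2 / (T + 1)).
have eta0 : 0 < eta by rewrite lt_min !divr_gt0 // ltr_wpDl.
have eta2 : eta <= 1 / 2 by rewrite ge_min lexx.
have etaT : eta * T <= e / 2.
  apply: (@le_trans _ _ (e / 2 / (T + 1) * T)).
    by rewrite ler_wpM2r // ge_min lexx orbT.
  rewrite mulrAC ler_pdivrMr ?ltr_wpDl // ler_wpM2l ?lerDl // ltW //.
  by rewrite divr_gt0.
have e2 : 0 < e / 2 / (g i + 1) by rewrite !divr_gt0 // ltr_wpDl.
have h1 := near_cost _ eta0 eta2.
have h2 := near_mesh_lt e2.
apply: filterS2 h1 h2 => m [S /= -> hS] hm /=.
rewrite distrC; apply: (le_trans hS); rewrite [leRHS]splitr lerD //.
rewrite /grid mul1r; apply: (@le_trans _ _ (e / 2 / (g i + 1) * g i)).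
  by rewrite ler_wpM2r // ltW.
rewrite mulrAC ler_pdivrMr ?ltr_wpDl // ler_wpM2l ?lerDl // ltW //.
by rewrite divr_gt0.
Qed.

(** Two limits of the same skeleton integrals are identified: dominated convergence gives the left
    side, [integral_skeleton_cost_cvg] the right side. *)
Lemma integral_survival_cost_below g : (forall j, 0 <= g j) ->
  (\int[P i \x leb]_z survival_cost K g z = (path_cost lam mu g i N)%:E)%E.
Proof.
move=> g0; pose C := \sum_(j < N) g j.
have C0 : 0 <= C by exact: sumr_ge0.
have [m _ /(_ m (leqnn m)) im] := integrable_dominating C0.
(* Starting at level [m] makes every grid a refinement of the one carrying the dominating
   function. *)
pose f k := grid_lift (k + m) (fun n => alive_cost K g (k + m) n.+1).
have mf k : measurable_fun [set: Omega * measurableTypeR R] (f k).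
  by apply: measurable_grid_lift => n; exact: measurable_alive_cost.
have cf z : f ^~ z @ \oo --> survival_cost K g z.
  have := @survival_cost_cvg K g z.
  by rewrite -(cvg_shiftn m).
have df z k : (`|f k z| <= grid_lift m (alive_cost K (fun=> C) m) z)%E.
  exact: alive_cost_dominated.
have [||_ _ h] := dominated_convergence measurableT mf
  (measurable_survival_cost K g) _ im _.
- by apply: aeW => z _; exact: cf.
- by apply: aeW => z k _; exact: df.
apply: cvg_unique h _ => //.
by have := integral_skeleton_cost_cvg g0; rewrite -(cvg_shiftn m).
Qed.

Lemma survives_avoid w s : 0 <= s -> X 0 w = i ->
  ~ (\forall m \near \oo, jump_set X N m w) ->
  survives (X^~ w) (fun n => n != N) s <-> survives (X^~ w) K s.
Proof.
move=> s0 Xi nJ; split => [sN|sK t ts]; last first.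
  by have := sK t ts; rewrite /K => /ltn_eqF ->.
apply: contrapT => nK; apply: nJ.
apply: (crossing_jump (X_rc w) s0 _ sN nK).
by rewrite Xi.
Qed.

(** Stopped on hitting [N], as [tau] is, rather than on leaving [{n | n < N}]. *)
Definition passage_cost g w : \bar R :=
  (\int[leb]_s survival_cost (fun n => n != N) g (w, s))%E.

Lemma measurable_passage_cost g : (forall j, 0 <= g j) ->
  measurable_fun setT (passage_cost g).
Proof.
move=> g0; apply: (@measurable_fun_fubini_tonelli_F _ _ _ _ _ leb).
  exact: measurable_survival_cost.
by move=> z; exact: survival_cost_ge0.
Qed.

Lemma passage_cost_ge0 g w : (forall j, 0 <= g j) -> (0 <= passage_cost g w)%E.
Proof. by move=> g0; apply: integral_ge0 => s _; exact: survival_cost_ge0. Qed.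

(** The two stopping rules agree on almost every path, since a path starting below [N] can separate
    them only by jumping over [N]. *)
Lemma integral_passage_cost g : (forall j, 0 <= g j) ->
  (\int[P i]_w passage_cost g w = (path_cost lam mu g i N)%:E)%E.
Proof.
move=> g0; rewrite -integral_survival_cost_below // fubini_tonelli1; last 2 first.
- exact: measurable_survival_cost.
- by move=> z; exact: survival_cost_ge0.
apply: ae_eq_integral => //; first exact: measurable_passage_cost.
  apply: measurable_fun_fubini_tonelli_F; first exact: measurable_survival_cost.
  by move=> z; exact: survival_cost_ge0.
have := ae_no_jump chainX lam_gt0 mu0 mu_gt0 iN.
apply: filterS => w [Xi nJ] _; apply: eq_integral => s _.
rewrite /survival_cost /=; case: ifPn => // s0.
by rewrite (asbool_equiv_eq (survives_avoid s0 Xi nJ)).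
Qed.

Lemma integrable_passage_cost g : (forall j, 0 <= g j) ->
  (P i).-integrable setT (passage_cost g).
Proof.
move=> g0; apply/integrableP; split; first exact: measurable_passage_cost.
under eq_integral do rewrite gee0_abs ?passage_cost_ge0 //.
by rewrite integral_passage_cost // ltry.
Qed.

(** For the strict inequality, right-continuity extends the avoidance of [N] to times before
    [s + e], so the infimum is at least [s + e]. *)
Lemma lt_tau w s : 0 <= s ->
  (s%:E < tau X N w)%E <-> survives (X^~ w) (fun n => n != N) s.
Proof.
move=> s0; split => [sN t /andP[t0 ts]|sN].
  apply/negP => /eqP Xt; move: sN; rewrite ltNge => /negP; apply.
  by apply: ge_ereal_inf; exists t%:E; [exists t | rewrite lee_fin].
have [e e0 he] := survives_right (X_rc w) s0 sN.
apply: (@lt_le_trans _ _ (s + e)%:E); first by rewrite lte_fin ltrDl.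
apply: le_ereal_inf_tmp => _ [t [t0 Xt] <-]; rewrite lee_fin leNgt.
by apply/negP => te; have := he t; rewrite t0 te Xt eqxx => /(_ isT).
Qed.

Lemma passage_costE g w :
  (\int[leb]_(s in [set s : R | (0 <= s)%R /\ s%:E < tau X N w])
     (g (X s w))%:E)%E = passage_cost g w.
Proof.
rewrite integral_mkcond; apply: eq_integral => s _.
rewrite patchE /survival_cost /=; case: (boolP (0 <= s)) => [s0|s0]; last first.
  by rewrite memNset // => -[s0']; rewrite s0' in s0.
case: asboolP => [sN|sN].
  by rewrite mem_set //=; split => //; exact/lt_tau.
by rewrite memNset //= => -[_ h]; apply: sN; exact/lt_tau.
Qed.

(** At unit rate the cost is the Lebesgue measure of the times in [[0, tau)], a bounded interval or
    a half-line. *)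
Lemma passage_cost1 w : passage_cost (fun=> 1) w = tau X N w.
Proof.
rewrite -passage_costE.
have tau0 : (0 <= tau X N w)%E.
  by apply: le_ereal_inf_tmp => _ [t [t0 _] <-]; rewrite lee_fin.
have [b Eb lb] : exists2 b : itv_bound R,
    [set s : R | 0 <= s /\ (s%:E < tau X N w)%E] = [set` Interval (BLeft 0) b]
    & leb [set` Interval (BLeft 0) b] = tau X N w.
  case: (tau X N w) tau0 => [r||] // r0.
    exists (BLeft r).
      by apply/seteqP; split => s /=; rewrite in_itv /= lte_fin => /andP.
    apply: etrans (lebesgue_measure_itv _) _ => /=.
    rewrite lee_fin in r0; rewrite lte_fin sube0.
    by case: ltgtP r0 => // <-.
  exists +oo%O.
    apply/seteqP; split => s /=; rewrite in_itv /= andbT; first by case.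
    by move=> ->; rewrite ltry.
  apply: etrans (lebesgue_measure_itv _) _ => /=.
  by rewrite ltry addye.
rewrite Eb integral_cst; last exact: measurable_itv.
by rewrite mul1e; exact: lb.
Qed.

Lemma integral_tau : (\int[P i]_w tau X N w =
  (path_cost lam mu (fun=> 1) i N)%:E)%E.
Proof.
rewrite -integral_passage_cost //.
by apply: eq_integral => w _; rewrite passage_cost1.
Qed.

Lemma integral_cost (c : nat -> R) :
  (\int[P i]_w
     \int[leb]_(s in [set s : R | (0 <= s)%R /\ s%:E < tau X N w])
       (c (X s w))%:E = (path_cost lam mu c i N)%:E)%E.
Proof.
(* Signed rates are split into positive and negative parts; both have integrable passage costs, so
   the difference may be integrated termwise, and [path_cost] is linear in the rates. *)
pose cp j := Num.max (c j) 0; pose cn j := Num.max (- c j) 0.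
have cp0 j : 0 <= cp j by rewrite le_max lexx orbT.
have cn0 j : 0 <= cn j by rewrite le_max lexx orbT.
under eq_integral => w _.
  rewrite integralE.
  under eq_integral do rewrite funeposE -EFin_max -/(cp _).
  under [X in (_ - X)%E]eq_integral do rewrite funenegE -EFinN -EFin_max -/(cn _).
  rewrite !passage_costE; over.
rewrite integralB //=; last 2 first.
- exact: integrable_passage_cost.
- exact: integrable_passage_cost.
rewrite !integral_passage_cost // -EFinB -path_costB; congr EFin.
congr path_cost; apply/funext => j; rewrite /cp /cn.
by case: (lerP (c j) 0) => cj; case: (lerP (- c j) 0) => cj'; lra.
Qed.

End start.
End survival_cost.

(** * The stationary law and the error formulas *)

(** [limn] is meaningful only for a convergent sequence, so convergence is first drawn from the
    finite extended sum; the limit then dominates the first partial sum. *)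
Lemma bd_pi_total_gt0 (R : realType) (lam mu : nat -> R) :
  (forall n, 0 < lam n) -> (forall n, (1 <= n)%N -> 0 < mu n) ->
  (\sum_(0 <= n <oo) (bd_pi lam mu n)%:E < +oo)%E ->
  0 < limn (series (bd_pi lam mu)).
Proof.
move=> lam_gt0 mu_gt0 sum_fin.
have pi0 n : 0 < bd_pi lam mu n by exact: bd_pi_gt0.
have nd : nondecreasing_seq (series (bd_pi lam mu)).
  by apply: nondecreasing_series => n _ _; exact: ltW.
have cs : cvgn (series (bd_pi lam mu)).
  apply: nondecreasing_is_cvgn => //.
  exists (fine (\sum_(0 <= n <oo) (bd_pi lam mu n)%:E)) => _ [n _ <-].
  rewrite -lee_fin fineK; last first.
    rewrite ge0_fin_numE // nneseries_ge0 // => k _ _.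
    by rewrite lee_fin ltW.
  rewrite /series /= -sumEFin; apply: nneseries_lim_ge => k _ _.
  by rewrite lee_fin ltW.
apply: lt_le_trans (nondecreasing_cvgn_le nd cs 1%N).
by rewrite /series /= big_nat1.
Qed.

(** Both the normalizing constant of [bd_p] and the factor [lam n * bd_pi lam mu n] of [step_costE]
    cancel in the ratio. *)
Lemma ZcumE (R : realType) (lam mu c : nat -> R) n :
  (forall n, 0 < lam n) -> (forall n, (1 <= n)%N -> 0 < mu n) ->
  (\sum_(0 <= n <oo) (bd_pi lam mu n)%:E < +oo)%E ->
  Zcum lam mu c n = step_cost lam mu c n / step_cost lam mu (fun=> 1) n.
Proof.
move=> lam_gt0 mu_gt0 sum_fin.
have S0 := bd_pi_total_gt0 lam_gt0 mu_gt0 sum_fin.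
have T0 := step_cost1_gt0 lam_gt0 mu_gt0 n; move: T0.
rewrite !step_costE // => T0.
have lp : 0 < lam n * bd_pi lam mu n by rewrite mulr_gt0 ?bd_pi_gt0.
have P0 : 0 < \sum_(0 <= j < n.+1) 1 * bd_pi lam mu j.
  by move: T0; rewrite pmulr_lgt0 // invr_gt0.
rewrite /Zcum.
have -> : Ccum lam mu c n = (\sum_(0 <= j < n.+1) c j * bd_pi lam mu j) /
    limn (series (bd_pi lam mu)).
  by rewrite mulr_suml; apply: eq_bigr => j _; rewrite mulrA.
have -> : Pcum lam mu n = (\sum_(0 <= j < n.+1) 1 * bd_pi lam mu j) /
    limn (series (bd_pi lam mu)).
  by rewrite mulr_suml; apply: eq_bigr => j _; rewrite mul1r.
by field; rewrite (gt_eqF S0) (gt_eqF P0) !gt_eqF ?bd_pi_gt0 //.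
Qed.

Theorem proposition5p1 (R : realType) (d : measure_display)
    (Omega : measurableType d) (P : nat -> probability Omega R)
    (X : R -> Omega -> nat) (lam mu c : nat -> R)
    (lam_gt0 : forall n, 0 < lam n)
    (mu_gt0 : forall n, (1 <= n)%N -> 0 < mu n)
    (mu0 : mu 0%N = 0)
    (recurrent : (\sum_(0 <= n <oo) ((lam n * bd_pi lam mu n)^-1)%:E = +oo)%E)
    (pi_summable : (\sum_(0 <= n <oo) (bd_pi lam mu n)%:E < +oo)%E)
    (c_summable : (\sum_(0 <= n <oo) (`|c n| * bd_p lam mu n)%:E < +oo)%E)
    (chainX : birth_death_chain lam mu P X)
    (zetahat a : R) :
  let ze := zeta lam mu c in
  let phi := frec lam mu c ze in
  let phihat := frec lam mu c zetahat in
  let b := bias lam mu c a ze in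
  let bhat := bias lam mu c a zetahat in
  [/\ (forall n : nat,
         Eabs (phihat n) (phi n) = Tplus P X n * Eabs zetahat ze),
      (forall n : nat, ze != 0 -> phi n != 0 ->
         Erel (phihat n) (phi n) = ze * (Tplus P X n / phi n) * Erel zetahat ze
         /\ ze * (Tplus P X n / phi n) * Erel zetahat ze =
            ze / (ze - Zcum lam mu c n) * Erel zetahat ze),
      (forall n : nat, (1 <= n)%N ->
         Eabs (bhat n) (b n) = T0 P X n * Eabs zetahat ze)
    & (forall n : nat, (1 <= n)%N -> ze != 0 -> b n != 0 ->
         Erel (bhat n) (b n) = ze * (T0 P X n / b n) * Erel zetahat ze
         /\ ze * (T0 P X n / b n) * Erel zetahat ze =
            ze / (a / T0 P X n + ze - Z0 P X c n) * Erel zetahat ze)].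
Proof.
move=> ze phi phihat b bhat.
have TplusE n : Tplus P X n = step_cost lam mu (fun=> 1) n.
  rewrite /Tplus (integral_tau chainX lam_gt0 mu_gt0 mu0 (ltnSn n)) /=.
  exact: big_nat1.
have T0E n : (1 <= n)%N -> T0 P X n = path_cost lam mu (fun=> 1) 0 n.
  by move=> n1; rewrite /T0 (integral_tau chainX lam_gt0 mu_gt0 mu0 n1).
have H0E n : (1 <= n)%N -> H0 P X c n = path_cost lam mu c 0 n.
  by move=> n1; rewrite /H0 (integral_cost chainX lam_gt0 mu_gt0 mu0 n1).
have errphi n : Eabs (phihat n) (phi n) = Tplus P X n * Eabs zetahat ze.
  by rewrite TplusE /Eabs /phihat /phi !frecE; ring.
have errb n : (1 <= n)%N -> Eabs (bhat n) (b n) = T0 P X n * Eabs zetahat ze.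
  by move=> n1; rewrite T0E // /Eabs /bhat /b !biasE; ring.
split=> // n.
- move=> ze0 phi0; split; first by rewrite /Erel errphi; field; rewrite ze0 phi0.
  have T0 : step_cost lam mu (fun=> 1) n != 0.
    by rewrite gt_eqF // step_cost1_gt0.
  (* By [frecE], [ze - Zcum lam mu c n] is [phi n] divided by the expected passage time from [n] to
     [n.+1]. *)
  congr (_ * _); congr (_ * _); rewrite TplusE ZcumE //.
  move: phi0; rewrite /phi frecE => phi0; field.
  by rewrite T0 phi0.
- move=> n1 ze0 b0; split; first by rewrite /Erel errb //; field; rewrite ze0 b0.
  have T0 : path_cost lam mu (fun=> 1) 0 n != 0.
    by rewrite gt_eqF // path_cost1_gt0.
  (* By [biasE], the denominator on the right is [b n] divided by the expected passage time from [0]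
     to [n]. *)
  congr (_ * _); congr (_ * _); rewrite /Z0 H0E // T0E //.
  move: b0; rewrite /b biasE => b0; field.
  by rewrite T0 -addrA b0.
Qed.
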